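(* Let $G$ be a group and suppose that $A,B\leqslant G$ are retracts of $G$ such that the corresponding retractions $\rho_A,\rho_B\in\mathrm{End}(G)$ commute. Then for arbitrary elements $x\in A$ and $y\in B$, $x$ is conjugate to $y$ in $G$ if and only if the following three conditions hold: (1) $\rho_A(y)\in x^A$; (2) $\rho_B(x)\in y^B$; (3) $\rho_{A\cap B}(y)\in \rho_{A\cap B}(x)^{A\cap B}$.
   Context: For a group $G$, a subset $T\subseteq G$ and $x\in G$, write $x^T=\{t^{-1}xt\mid t\in T\}$. A subgroup $A\leqslant G$ is a retract of $G$ if there is an endomorphism $\rho_A:G\to G$ (a retraction of $G$ onto $A$) with $\rho_A(G)=A$ and $\rho_A(h)=h$ for all $h\in A$. Retractions $\rho_A$ and $\rho_B$ commute if $\rho_A(\rho_B(g))=\rho_B(\rho_A(g))$ for all $g\in G$; in that case $\rho_{A\cap B}:=\rho_A\circ\rho_B=\rho_B\circ\rho_A$, which is a retraction of $G$ onto $A\cap B$. *)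

(* Defs.v *)
From HB Require Import structures.
From mathcomp Require Import all_boot.
From mathcomp Require Import all_classical.

Set Implicit Arguments.
Unset Strict Implicit.
Unset Printing Implicit Defensive.

Local Open Scope group_scope.
Local Open Scope classical_set_scope.

(* Subgroups are Prop-valued sets, so no decidability of membership is
   assumed; [in A] is the predicate that group_closed of monoid.v expects. *)
Definition is_subgroup (G : groupType) (A : set G) : Prop :=
  group_closed [in A].

(* {multiplicative G -> G} is the type of endomorphisms of the group G
   (preservation of 1 and of inverses follows). *)
Definition is_retraction (G : groupType) (A : set G)
    (rho : {multiplicative G -> G}) : Prop :=
  range rho = A /\ (forall h : G, A h -> rho h = h).

Definition retractions_commute (G : groupType)
    (rhoA rhoB : {multiplicative G -> G}) : Prop :=
  forall g : G, rhoA (rhoB g) = rhoB (rhoA g).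

(* x^T in the sense of conjugation: x ^ t = t^-1 * (x * t). *)
Definition conj_set (G : groupType) (x : G) (T : set G) : set G :=
  [set x ^ t | t in T].

Definition conjugate (G : groupType) (x y : G) : Prop :=
  exists g : G, x ^ g = y.

(* Main.v *)
Require Import Defs.
From HB Require Import structures.
From mathcomp Require Import all_boot.
From mathcomp Require Import all_classical.

(** Endomorphisms preserve conjugacy and carry the conjugating element along.
    Hence if [x ^ g = y], applying [rhoA], [rhoB] and their composite gives
    the three conditions, with conjugators [rhoA g], [rhoB g^-1] and
    [rhoA (rhoB g)]: the retractions fix [x] and [y] respectively and push
    the conjugator into the required subgroup.

    For the converse, commutation gives [rhoA (rhoB x) = rhoB x] for [x] in
    [A]; also [rhoA (rhoB y) = rhoA y] for [y] in [B].  The three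
    conditions are therefore the links of a chain of conjugate elements
    running from [x] through [rhoA y] and [rhoB x] to [y]. *)

Local Open Scope group_scope.
Local Open Scope classical_set_scope.

Lemma retraction_in (G : groupType) (A : set G)
    (rho : {multiplicative G -> G}) (g : G) :
  is_retraction A rho -> A (rho g).
Proof. by case=> <- _; exists g. Qed.

(** Cancelling [f y] in the image of [y * x ^ y = x * y] avoids having to know
    that [f] preserves [1] and inverses. *)
Lemma multiplicative_conj (G H : groupType) (f : {multiplicative G -> H})
    (x y : G) :
  f (x ^ y) = f x ^ f y.
Proof. by apply: (mulgI (f y)); rewrite -gmulfM -!conjgC gmulfM. Qed.

Theorem lemma2p5 (G : groupType) (A B : set G)
    (sgA : is_subgroup A) (sgB : is_subgroup B)
    (rhoA rhoB : {multiplicative G -> G})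
    (retrA : is_retraction A rhoA) (retrB : is_retraction B rhoB)
    (commAB : retractions_commute rhoA rhoB)
    (x y : G) (Ax : A x) (By : B y) :
  let rhoAB : G -> G := rhoA \o rhoB in
  conjugate x y <->
  [/\ conj_set x A (rhoA y),
      conj_set y B (rhoB x)
    & conj_set (rhoAB x) (A `&` B) (rhoAB y)].
Proof.
move=> rhoAB; rewrite /rhoAB /=.
have rhoAx : rhoA x = x by case: retrA => _; apply.
have rhoBy : rhoB y = y by case: retrB => _; apply.
split=> [[g xg_y] | [[a _ xa] [b _ yb] [c _ xyc]]].
  split.
  - exists (rhoA g); first exact: retraction_in.
    by rewrite -xg_y multiplicative_conj rhoAx.
  - exists (rhoB g^-1); first exact: retraction_in.
    by rewrite -{1}rhoBy -multiplicative_conj -xg_y conjgK.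
  - exists (rhoA (rhoB g)); last by rewrite -xg_y !multiplicative_conj.
    by split; [|rewrite commAB]; apply: retraction_in.
(* The path from x to y is x -a-> rhoA y <-c- rhoB x <-b- y. *)
exists (a * c^-1 * b^-1).
by rewrite !conjgM xa -{1}rhoBy -xyc conjgK commAB rhoAx -yb conjgK.
Qed.
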